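(* For $p=3$ and a prime $\ell\ge5$, the congruence $p\equiv-1\pmod\ell$ never occurs. Hence, with $f$, $N$, $\bar\rho$ as in the context, if $9\mid N$ and the inertial type at $3$ is any of the supercuspidal types at $3$ listed in the context, then $H^0(G_3,\bar\varepsilon_\ell\otimes\mathrm{ad}^0\bar\rho)=0$ for every $\ell\ge5$, regardless of the residue of $3$ modulo $\ell$; that is, the deformation problem is locally unobstructed at $3$.
   Context: $f$ is a normalized weight $2$ newform of level $N$ corresponding to an elliptic curve $E_f/\mathbb{Q}$ of conductor $N$, $\kappa$ is a finite field of characteristic $\ell$ with $\ell\nmid N$, $S$ is a finite set of places of $\mathbb{Q}$ containing $\infty$ and the primes dividing $N\ell$, and $\bar\rho:G_{\mathbb{Q},S}\to\mathrm{GL}_2(\kappa)$ is the residual representation attached to $f$. Throughout: $\bar\rho$ is odd, continuous and absolutely irreducible, $f$ is ordinary at $\ell$ ($a_\ell(f)\not\equiv0\bmod\ell$), and the deformation problem for $\bar\rho$ is minimally ramified at all primes dividing $N$; at a prime $p$ of supercuspidal type this means that deformations restricted to $G_p$ are of the form $\mathrm{Ind}_{G_K}^{G_p}\chi$ with $\chi$ a lift of $\bar\chi$ (below) of the same conductor exponent. $G_3$ is a decomposition group at $3$; $\bar\varepsilon_\ell$ is the mod $\ell$ cyclotomic character; $\mathrm{ad}^0\bar\rho$ is the space of trace-zero $2\times2$ matrices over $\kappa$ with conjugation action via $\bar\rho$. The deformation problem has a local obstruction at $p$ if $H^0(G_p,\bar\varepsilon_\ell\otimes\mathrm{ad}^0\bar\rho)\ne0$,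 and is locally unobstructed at $p$ otherwise. $E_f$ has additive, potentially good reduction at $3$. $\tau_{\mathrm{sc},3}(d,c,r)$ denotes the inertial type of $\mathrm{Ind}_{G_K}^{G_3}\chi$ with $K=\mathbb{Q}_3(\sqrt d)$, $\chi$ of conductor exponent $c$ and order $r$ on $I_K$. The supercuspidal types at $3$ are: with $K=\mathbb{Q}_3(\sqrt{-1})$ unramified, $\tau_{\mathrm{sc},3}(-1,1,4)$, $\tau_{\mathrm{sc},3}(-1,2,3)$ and $\tau_{\mathrm{sc},3}(-1,2,3)\otimes\varepsilon_3$, where $\varepsilon_3$ is the quadratic character of $\mathbb{Q}_3(\sqrt3)/\mathbb{Q}_3$; with $K$ ramified, $\tau_{\mathrm{sc},3}(\pm3,2,6)$, and $\tau_{\mathrm{sc},3}(-3,4,6)_j$ for $j=0,1,2$, where the inducing character $\chi_j$, viewed on $\mathcal{O}_K^\times$ by class field theory, satisfies $\chi_j(-\xi_6)=\zeta_3^{\,j}$ and $\chi_j(\xi_6-3)=-\zeta_3^{\,j-1}$, with $\xi_6\in K$ a primitive sixth root of unity and $\zeta_3$ a primitive cube root of unity. Residually $\bar\rho|_{G_3}\cong\mathrm{Ind}_{G_K}^{G_3}\bar\chi$, where $\bar\chi$ is the reduction of the inducing character, $\bar\chi\ne\bar\chi^s$ with $\bar\chi^s$ the conjugate of $\bar\chi$ under $\mathrm{Gal}(K/\mathbb{Q}_3)$. *)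

(* Defs.v *)
From HB Require Import structures.
From mathcomp Require Import all_boot all_order all_algebra all_field.
From mathcomp Require Import all_classical all_reals all_analysis.
From mathcomp Require Import complex.
Set Implicit Arguments.
Unset Strict Implicit.
Unset Printing Implicit Defensive.
Import Order.TTheory GRing.Theory Num.Theory.
Import numFieldNormedType.Exports.
Local Open Scope classical_set_scope.
Local Open Scope ring_scope.

Section Newforms.
Variable R : realType.
Local Notation C := R[i].

(* Modular forms are total functions C -> C of which only the values on the
   upper half plane matter. *)
Definition upper : set C := [set z | 0 < complex.Im z].

(* q z = exp (2 pi i z) *)
Definition qparam (z : C) : C :=
  let r := expR (- (2 * pi * complex.Im z)) in
  let t := 2 * pi * complex.Re z in
  Complex (r * cos t) (r * sin t).

Definition SL2Z (g : 'M[int]_2) : Prop := \det g = 1.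
Definition Gamma0 (N : nat) (g : 'M[int]_2) : Prop :=
  SL2Z g /\ (N%:Z %| g 1%R 0%R)%Z.

Definition slash2 (f : C -> C) (g : 'M[int]_2) (z : C) : C :=
  let den := (g 1 0)%:~R * z + (g 1 1)%:~R in
  den ^- 2 * f (((g 0 0)%:~R * z + (g 0 1)%:~R) / den).

Definition cusp_form2 (N : nat) (f : C -> C) : Prop :=
  [/\ forall z, upper z -> derivable (f : C^o -> C^o) z 1,
      forall g z, Gamma0 N g -> upper z -> slash2 f g z = f z
    & forall g (e : R), SL2Z g -> 0 < e ->
        exists B : R, forall z, B < complex.Im z -> 0 < complex.Im z ->
          `|slash2 f g z| < e%:C%C].

(* In weight 2 the invariant measure times y^2 is dx dy.  The fundamental
   domain of Gamma0(N) is the union of the translates of the standard one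
   F of SL2(Z) by representatives gs of Gamma0(N)\SL2(Z). *)
Definition fund_SL2Z : set (R * R) :=
  [set xy | [/\ `|xy.1| <= 2^-1, 0 < xy.2 & 1 <= xy.1 ^+ 2 + xy.2 ^+ 2]].

Definition int_fund (F : C -> C) : C :=
  let mu := (lebesgue_measure \x lebesgue_measure)%E in
  Complex (\int[mu]_(w in fund_SL2Z) complex.Re (F (Complex w.1 w.2)))
          (\int[mu]_(w in fund_SL2Z) complex.Im (F (Complex w.1 w.2))).

Definition Gamma0_reps (N n : nat) (gs : 'I_n -> 'M[int]_2) : Prop :=
  (forall i, SL2Z (gs i)) /\
  (forall g, SL2Z g -> exists! i, Gamma0 N (g *m invmx (gs i))).

Definition petersson_orthogonal (N : nat) (f h : C -> C) : Prop :=
  forall n (gs : 'I_n -> 'M[int]_2), Gamma0_reps N gs ->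
    \sum_(i < n) int_fund (fun z => slash2 f (gs i) z * (slash2 h (gs i) z)^*)
    = 0.

Definition hecke2 (N p : nat) (f : C -> C) (z : C) : C :=
  p%:R^-1 * (\sum_(b < p) f ((z + b%:R) / p%:R))
  + (if (p %| N)%N then 0 else p%:R * f (p%:R * z)).

(* f is orthogonal to all oldforms h(dz), h of level M with M d | N, M < N *)
Definition new2 (N : nat) (f : C -> C) : Prop :=
  forall (M d : nat) (h : C -> C),
    (0 < M)%N -> (0 < d)%N -> (M < N)%N -> (M * d %| N)%N -> cusp_form2 M h ->
    petersson_orthogonal N f (fun z => h (d%:R * z)).

(* a n is the n-th Fourier coefficient; it is a rational integer for the
   forms attached to elliptic curves over Q. *)
Definition newform2 (N : nat) (f : C -> C) (a : nat -> int) : Prop :=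
  [/\ cusp_form2 N f, new2 N f,
      forall p, prime p -> exists c : C,
        forall z, upper z -> hecke2 N p f z = c * f z,
      forall z, upper z ->
        series (fun n => ((a n)%:~R * qparam z ^+ n : C^o)) @ \oo --> (f z : C^o)
    & a 0%N = 0 /\ a 1%N = 1].

End Newforms.

(* algC is an algebraic closure of Q, and its field endomorphisms are
   automorphisms. *)
Notation galQ := ({rmorphism algC -> algC}).
Definition gid : galQ := idfun.
Definition gmul (s t : galQ) : galQ := s \o t.
Definition ginv (s : galQ) : galQ := algC_invaut s.

Definition galSubgroup (H : set galQ) : Prop :=
  [/\ H gid, forall s t, H s -> H t -> H (gmul s t)
    & forall s, H s -> H (ginv s)].

Definition fixed_field (H : set galQ) : set algC :=
  [set x | forall s, H s -> s x = x].

Definition fixes (s : galQ) (e : seq algC) : Prop := {in e, forall x, s x = x}.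

(* V is the valuation ring of a place of algC above the prime p. *)
Definition is_place (p : nat) (V : set algC) : Prop :=
  [/\ V 1, forall x y, V x -> V y -> V (x - y),
      forall x y, V x -> V y -> V (x * y),
      forall x, V x \/ V x^-1
    & ~ V (p%:R^-1)].

Definition place_ideal (V : set algC) : set algC :=
  [set x | V x /\ (x = 0 \/ ~ V x^-1)].

(* With V above p, decomp V is G_p = Gal(Qbar_p/Q_p): the fixed field of
   decomp V is the henselization of Q at p, i.e. the field of algebraic numbers
   in Q_p.  All finite extensions of Q_p below are represented by the
   corresponding finite extensions of this field inside algC, which have the
   same Galois groups, residue fields and value groups. *)
Definition decomp (V : set algC) : set galQ :=
  [set s | forall x, V (s x) <-> V x].
Definition inertia (V : set algC) : set galQ :=
  [set s | decomp V s /\ forall x, V x -> place_ideal V (s x - x)].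
Definition is_frob (V : set algC) (q : nat) (s : galQ) : Prop :=
  decomp V s /\ forall x, V x -> place_ideal V (s x - x ^+ q).

Definition quad_subgroup (V : set algC) (d : int) : set galQ :=
  [set s | decomp V s /\ s (sqrtC d%:~R) = sqrtC d%:~R].

Definition uniformizer (V K : set algC) (x : algC) : Prop :=
  [/\ K x, x != 0, place_ideal V x
    & forall y, K y -> place_ideal V y -> V (y / x)].

Definition residue_card (V K : set algC) (q : nat) : Prop :=
  exists r : 'I_q -> algC, (forall i, K (r i) /\ V (r i)) /\
    forall x, K x -> V x -> exists! i, place_ideal V (x - r i).

(* c = 0 gives the unit group of the valuation ring of K *)
Definition unit_filtration (V K : set algC) (c : nat) : set algC :=
  [set u | [/\ K u, u != 0, V u, V u^-1
             & forall x, uniformizer V K x -> V ((u - 1) / x ^+ c)]].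

Definition coset_reps (G H : set galQ) (n : nat) (r : 'I_n -> galQ) : Prop :=
  (forall i, G (r i)) /\
  (forall s, G s -> exists! i, H (gmul (ginv (r i)) s)).

Definition has_index (G H : set galQ) (n : nat) : Prop :=
  exists r : 'I_n -> galQ, coset_reps G H r.

(* The open subgroups of G with abelian quotient, i.e. the finite abelian
   extensions of the fixed field of G. *)
Definition abelian_open (G H : set galQ) : Prop :=
  [/\ galSubgroup H, H `<=` G,
      exists e, forall s, G s -> fixes s e -> H s
    & forall s t, G s -> G t ->
        H (gmul (gmul (ginv s) (ginv t)) (gmul s t))].

(* rec lifts to G the local reciprocity map K^* -> G^ab, which is characterized
   by its values on uniformizers (arithmetic Frobenius) and on norms. *)
Definition local_reciprocity (V : set algC) (G : set galQ) (rec : algC -> galQ)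
  : Prop :=
  let K := fixed_field G in
  [/\ forall x, K x -> x != 0 -> G (rec x),
      forall H x y, abelian_open G H -> K x -> K y -> x != 0 -> y != 0 ->
        H (gmul (ginv (rec (x * y))) (gmul (rec x) (rec y))),
      forall H n (r : 'I_n -> galQ) x, abelian_open G H -> coset_reps G H r ->
        fixed_field H x -> x != 0 -> H (rec (\prod_(i < n) r i x))
    & forall x q, uniformizer V K x -> residue_card V K q ->
        is_frob V q (rec x)].

Definition char_conductor (A : comUnitRingType) (V : set algC) (G : set galQ)
    (chi : galQ -> A) (c : nat) : Prop :=
  exists rec, [/\ local_reciprocity V G rec,
    forall u, unit_filtration V (fixed_field G) c u -> chi (rec u) = 1
  & forall c', (c' < c)%N -> exists u,
      unit_filtration V (fixed_field G) c' u /\ chi (rec u) <> 1].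

(* x lies in the n-th power of the kernel of red *)
Definition max_pow (A k : comUnitRingType) (red : {rmorphism A -> k}) (n : nat)
  : set A :=
  [set x | exists (m : nat) (c : 'I_m -> A) (a : 'I_m -> 'I_n -> A),
     (forall i j, red (a i j) = 0) /\
     x = \sum_(i < m) c i * \prod_(j < n) a i j].

Definition is_ideal (A : comUnitRingType) (I : set A) : Prop :=
  [/\ I 0, forall x y, I x -> I y -> I (x + y) & forall a x, I x -> I (a * x)].

(* Complete noetherian local ring with residue field k: the maximal ideal is
   the kernel of red. *)
Definition coefficient_ring (A : comUnitRingType) (k : fieldType)
    (red : {rmorphism A -> k}) : Prop :=
  [/\ forall y, exists x, red x = y,
      forall x, red x != 0 -> x \is a GRing.unit,
      forall I : set A, is_ideal I -> exists (m : nat) (g : 'I_m -> A),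
        forall x, I x <-> exists c : 'I_m -> A, x = \sum_(i < m) c i * g i,
      forall x, (forall n, max_pow red n x) -> x = 0
    & forall u : nat -> A, (forall n, max_pow red n (u n.+1 - u n)) ->
        exists x, forall n, max_pow red n (u n - x)].

(* ring of integers of a finite extension of Q_l with residue field k, where l
   is the characteristic of k *)
Definition padic_integers (A : idomainType) (k : fieldType)
    (red : {rmorphism A -> k}) : Prop :=
  [/\ coefficient_ring red, [pchar A] =i pred0
    & exists w, forall x, red x = 0 <-> exists y, x = w * y].

Section Representations.
Variables (A k : comUnitRingType) (red : {rmorphism A -> k}).

Definition is_rep (rho : galQ -> 'M[A]_2) : Prop :=
  (forall s, rho s \in unitmx) /\
  (forall s t, rho (gmul s t) = rho s *m rho t).

Definition continuous_rep (rho : galQ -> 'M[A]_2) : Prop :=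
  forall n, exists e, forall s, fixes s e ->
    forall i j, max_pow red n ((rho s - 1%:M) i j).

Definition unramified_outside (P : nat -> Prop) (rho : galQ -> 'M[A]_2) : Prop :=
  forall p V s, prime p -> ~ P p -> is_place p V -> inertia V s -> rho s = 1%:M.

(* continuous representations of G_{Q,S}; the infinite place is always in S *)
Definition galQS_rep (S : seq nat) (rho : galQ -> 'M[A]_2) : Prop :=
  [/\ is_rep rho, continuous_rep rho & unramified_outside (fun p => p \in S) rho].

(* Only the values of chi on the subgroup G matter. *)
Definition is_character (G : set galQ) (chi : galQ -> A) : Prop :=
  [/\ forall s, G s -> chi s \is a GRing.unit,
      forall s t, G s -> G t -> chi (gmul s t) = chi s * chi t
    & forall n, exists e, forall s, G s -> fixes s e -> max_pow red n (chi s - 1)].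

End Representations.

(* The matrices of the representation induced from a character chi of a
   subgroup GK of index 2, with coset representatives 1 and s. *)
Definition ind_mx (A : comUnitRingType) (GK : set galQ) (chi : galQ -> A)
    (s : galQ) (t : galQ) : 'M[A]_2 :=
  let r (i : 'I_2) := if i == 0 then gid else s in
  \matrix_(i, j) let u := gmul (ginv (r i)) (gmul t (r j)) in
                 if `[< GK u >] then chi u else 0.

(* rho and Ind_{GK}^G chi are isomorphic in restriction to the subgroup H
   of G. *)
Definition iso_ind (A : comUnitRingType) (G GK H : set galQ)
    (rho : galQ -> 'M[A]_2) (chi : galQ -> A) : Prop :=
  exists s g, [/\ G s, ~ GK s, g \in unitmx
    & forall t, H t -> rho t *m g = g *m ind_mx GK chi s t].

(* the same over the fraction field of A, denominators of g being cleared *)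
Definition iso_ind_frac (A : idomainType) (G GK H : set galQ)
    (rho : galQ -> 'M[A]_2) (chi : galQ -> A) : Prop :=
  exists s g, [/\ G s, ~ GK s, \det g != 0
    & forall t, H t -> rho t *m g = g *m ind_mx GK chi s t].

Definition neq_conj (A : Type) (G GK : set galQ) (chi : galQ -> A) : Prop :=
  forall s, G s -> ~ GK s ->
    exists t, GK t /\ chi t <> chi (gmul (ginv s) (gmul t s)).

Definition cyclo_exp (l : nat) (s : galQ) : nat :=
  odflt 0%N (omap (@nat_of_ord l)
    [pick n : 'I_l | `[< forall z : algC, z ^+ l = 1 -> s z = z ^+ n >]]).
Definition cyclo (k : fieldType) (l : nat) (s : galQ) : k := (cyclo_exp l s)%:R.

Definition conjC_gal : galQ := Num.conj.
Definition odd_rep (k : fieldType) (rho : galQ -> 'M[k]_2) : Prop :=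
  \det (rho conjC_gal) = -1.

Definition abs_irreducible (k : fieldType) (rho : galQ -> 'M[k]_2) : Prop :=
  forall (L : fieldType) (j : {rmorphism k -> L}) (v : 'cV[L]_2), v != 0 ->
    ~ (forall s, exists c, map_mx j (rho s) *m v = c *: v).

(* a is the sequence of Fourier coefficients of a newform of weight 2, level N
   and trivial character *)
Definition residual_rep_of (k : fieldType) (N l : nat) (a : nat -> int)
    (rho : galQ -> 'M[k]_2) : Prop :=
  [/\ unramified_outside (fun p => (p %| N * l)%N) rho,
      forall p V s, prime p -> ~~ (p %| N * l)%N -> is_place p V ->
        is_frob V p s -> \tr (rho s) = (a p)%:~R
    & forall s, \det (rho s) = cyclo k l s].

Record weierstrass (F : Type) :=
  Weierstrass { wa1 : F; wa2 : F; wa3 : F; wa4 : F; wa6 : F }.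

Definition map_weierstrass (F F' : Type) (h : F -> F') (E : weierstrass F) :=
  Weierstrass (h (wa1 E)) (h (wa2 E)) (h (wa3 E)) (h (wa4 E)) (h (wa6 E)).

Definition on_coeffs (F : Type) (P : F -> Prop) (E : weierstrass F) : Prop :=
  [/\ P (wa1 E), P (wa2 E), P (wa3 E), P (wa4 E) & P (wa6 E)].

Section Weierstrass.
Variables (F : fieldType) (E : weierstrass F).
Let a1 := wa1 E. Let a2 := wa2 E. Let a3 := wa3 E.
Let a4 := wa4 E. Let a6 := wa6 E.
Let b2 := a1 ^+ 2 + 4 * a2.
Let b4 := 2 * a4 + a1 * a3.
Let b6 := a3 ^+ 2 + 4 * a6.
Let b8 := a1 ^+ 2 * a6 + 4 * a2 * a6 - a1 * a3 * a4 + a2 * a3 ^+ 2 - a4 ^+ 2.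

Definition wdisc : F :=
  - b2 ^+ 2 * b8 - 8 * b4 ^+ 3 - 27 * b6 ^+ 2 + 9 * b2 * b4 * b6.
Definition wc4 : F := b2 ^+ 2 - 24 * b4.

Definition weq (x y : F) : bool :=
  y ^+ 2 + a1 * x * y + a3 * y == x ^+ 3 + a2 * x ^+ 2 + a4 * x + a6.

(* None is the point at infinity *)
Definition on_curve (P : option (F * F)) : bool :=
  if P is Some xy then weq xy.1 xy.2 else true.

Definition wadd (P Q : option (F * F)) : option (F * F) :=
  match P, Q with
  | None, _ => Q
  | _, None => P
  | Some (x1, y1), Some (x2, y2) =>
    if (x1 == x2) && (y1 + y2 + a1 * x2 + a3 == 0) then None else
    let m := if x1 == x2
             then (3 * x1 ^+ 2 + 2 * a2 * x1 + a4 - a1 * y1)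
                    / (2 * y1 + a1 * x1 + a3)
             else (y2 - y1) / (x2 - x1) in
    let x3 := m ^+ 2 + a1 * m - a2 - x1 - x2 in
    Some (x3, - (m + a1) * x3 - (y1 - m * x1) - a3)
  end.

Definition wmul (n : nat) (P : option (F * F)) := iter n (wadd P) None.

Definition torsion (n : nat) : set (option (F * F)) :=
  [set P | on_curve P /\ wmul n P = None].

(* E' is obtained from E by x = u^2 x' + r, y = u^3 y' + u^2 s x' + t *)
Definition var_change (E' : weierstrass F) : Prop :=
  exists u r s t : F,
  [/\ u != 0,
      u * wa1 E' = a1 + 2 * s,
      u ^+ 2 * wa2 E' = a2 - s * a1 + 3 * r - s ^+ 2,
      u ^+ 3 * wa3 E' = a3 + r * a1 + 2 * t
    & u ^+ 4 * wa4 E' = a4 - s * a3 + 2 * r * a2 - (t + r * s) * a1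
                        + 3 * r ^+ 2 - 2 * s * t /\
      u ^+ 6 * wa6 E' = a6 + r * a4 + r ^+ 2 * a2 + r ^+ 3 - t * a3
                        - t ^+ 2 - r * t * a1].

End Weierstrass.

Definition p_integral (p : nat) (E : weierstrass rat) : Prop :=
  on_coeffs (fun x => ~~ (p%:Z %| denq x)%Z) E.

Definition minimal_model (p : nat) (E E' : weierstrass rat) : Prop :=
  [/\ var_change E E', p_integral p E'
    & forall E'', var_change E E'' -> p_integral p E'' ->
        (logn p `|numq (wdisc E')| <= logn p `|numq (wdisc E'')|)%N].

Definition good_reduction (p : nat) (E : weierstrass rat) : Prop :=
  exists E', minimal_model p E E' /\ ~~ (p%:Z %| numq (wdisc E'))%Z.
Definition multiplicative_reduction (p : nat) (E : weierstrass rat) : Prop :=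
  exists E', [/\ minimal_model p E E', (p%:Z %| numq (wdisc E'))%Z
               & ~~ (p%:Z %| numq (wc4 E'))%Z].
Definition additive_reduction (p : nat) (E : weierstrass rat) : Prop :=
  exists E', [/\ minimal_model p E E', (p%:Z %| numq (wdisc E'))%Z
               & (p%:Z %| numq (wc4 E'))%Z].

Definition over_algC (E : weierstrass rat) : weierstrass algC :=
  map_weierstrass ratr E.

(* good reduction over a finite extension: a model over algC has its
   coefficients in a finite extension *)
Definition potentially_good (V : set algC) (E : weierstrass rat) : Prop :=
  exists W, [/\ var_change (over_algC E) W, on_coeffs V W, wdisc W != 0
              & V (wdisc W)^-1].

Definition gal_point (s : galQ) (P : option (algC * algC)) :=
  omap (fun xy => (s xy.1, s xy.2)) P.

Definition fix_torsion (V : set algC) (E : weierstrass rat) (m : nat)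
  : set galQ :=
  [set s | decomp V s /\
     forall P, torsion (over_algC E) m P -> gal_point s P = P].

(* Inverse image in decomp V of the i-th ramification group (lower numbering)
   of the extension of Q_p generated by the m-torsion of E. *)
Definition ram_torsion (V : set algC) (E : weierstrass rat) (m i : nat)
  : set galQ :=
  let L := fixed_field (fix_torsion V E m) in
  [set s | decomp V s /\ forall x w, L x -> V x -> uniformizer V L w ->
     V ((s x - x) / w ^+ i.+1)].

(* The wild part of the conductor exponent at p:
   sum_(i >= 1) (g_i / g_0) dim_{F_m} (E[m] / E[m]^{G_i}) for a prime m <> p,
   where g_i is the order of the i-th ramification group G_i and k i is the
   dimension of E[m]^{G_i}. *)
Definition wild_conductor (p : nat) (E : weierstrass rat) (delta : nat) : Prop :=
  exists m V B (g k : nat -> nat),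
  [/\ prime m /\ m <> p, is_place p V,
      forall i, has_index (ram_torsion V E m i) (fix_torsion V E m) (g i),
      forall i, exists pts : seq (option (algC * algC)),
        [/\ uniq pts, size pts = (m ^ k i)%N
          & forall P, P \in pts <-> torsion (over_algC E) m P /\
              forall s, ram_torsion V E m i s -> gal_point s P = P]
    & (forall i, (B < i)%N -> g i = 1%N) /\
      (g 0 * delta = \sum_(1 <= i < B.+1) g i * (2 - k i))%N].

Definition conductor_exponent (p : nat) (E : weierstrass rat) (n : nat) : Prop :=
  [\/ good_reduction p E /\ n = 0%N,
      multiplicative_reduction p E /\ n = 1%N
    | additive_reduction p E /\
      exists delta, wild_conductor p E delta /\ n = (2 + delta)%N].

Definition has_conductor (E : weierstrass rat) (N : nat) : Prop :=
  (0 < N)%N /\ forall p, prime p -> conductor_exponent p E (logn p N).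

(* a_p(E) = p + 1 - #E(F_p), where E(F_p) is the set of all points (including
   the singular one, if any) of the reduction of a minimal model at p; this is
   the coefficient of p^-s in L(E, s) at the bad primes too. *)
Definition ap_reduced (p : nat) (E : weierstrass rat) : int :=
  let Ep : weierstrass 'F_p := map_weierstrass ratr E in
  p.+1%:Z - (#|[set xy : 'F_p * 'F_p | weq Ep xy.1 xy.2]%SET|.+1)%:Z.

Definition corresponds (a : nat -> int) (E : weierstrass rat) : Prop :=
  forall p E', prime p -> minimal_model p E E' -> a p = ap_reduced p E'.

(* rho is the representation on the l-adic Tate module of E (with coefficients
   extended to A), in a Z_l-basis given by the compatible systems P and Q *)
Definition tate_rep (A : comUnitRingType) (l : nat) (E : weierstrass rat)
    (rho : galQ -> 'M[A]_2) : Prop :=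
  let W := over_algC E in
  exists P Q : nat -> option (algC * algC),
  [/\ forall n, on_curve W (P n) /\ on_curve W (Q n),
      P 0%N = None /\ Q 0%N = None,
      forall n, wmul W l (P n.+1) = P n /\ wmul W l (Q n.+1) = Q n,
      forall n T, torsion W (l ^ n)%N T -> exists! ab : 'I_(l ^ n) * 'I_(l ^ n),
        T = wadd W (wmul W ab.1 (P n)) (wmul W ab.2 (Q n))
    & forall n s (a b : nat),
      (gal_point s (P n) = wadd W (wmul W a (P n)) (wmul W b (Q n)) ->
        (exists z, rho s 0 0 = a%:R + (l ^ n)%:R * z) /\
        (exists z, rho s 1 0 = b%:R + (l ^ n)%:R * z)) /\
      (gal_point s (Q n) = wadd W (wmul W a (P n)) (wmul W b (Q n)) ->
        (exists z, rho s 0 1 = a%:R + (l ^ n)%:R * z) /\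
        (exists z, rho s 1 1 = b%:R + (l ^ n)%:R * z))].

Inductive sc_type3 :=
| Sc_m1_1_4          (* tau_sc,3(-1,1,4) *)
| Sc_m1_2_3          (* tau_sc,3(-1,2,3) *)
| Sc_m1_2_3_twist    (* tau_sc,3(-1,2,3) (x) eps_3 *)
| Sc_p3_2_6          (* tau_sc,3(3,2,6) *)
| Sc_m3_2_6          (* tau_sc,3(-3,2,6) *)
| Sc_m3_4_6 of 'I_3. (* tau_sc,3(-3,4,6)_j *)

Definition sc_disc (tau : sc_type3) : int :=
  match tau with
  | Sc_m1_1_4 | Sc_m1_2_3 | Sc_m1_2_3_twist => -1
  | Sc_p3_2_6 => 3
  | Sc_m3_2_6 | Sc_m3_4_6 _ => -3
  end.

Section ScTypes.
Variables (A : comUnitRingType) (k : fieldType) (red : {rmorphism A -> k}).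
Variable V : set algC.

(* exact order of the restriction of chi to the inertia group of
   K = Q_p(sqrt d) *)
Definition order_on_inertia (d : int) (chi : galQ -> A) (r : nat) : Prop :=
  let I_K := inertia V `&` quad_subgroup V d in
  [/\ (0 < r)%N, forall s, I_K s -> chi s ^+ r = 1
    & forall r', (0 < r' < r)%N -> exists s, I_K s /\ chi s ^+ r' <> 1].

Definition sc_char (d : int) (c r : nat) (chi : galQ -> A) : Prop :=
  [/\ is_character red (quad_subgroup V d) chi,
      char_conductor V (quad_subgroup V d) chi c
    & order_on_inertia d chi r].

Definition eps3 (s : galQ) : A :=
  if s (sqrtC 3) == sqrtC 3 then 1 else -1.

(* chi is a character of G_K, K = Q_3(sqrt (sc_disc tau)), such that tau is the
   inertial type of Ind chi.  The twist of Ind psi by eps3 is induced from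
   psi times the restriction of eps3. *)
Definition inducing_char (tau : sc_type3) (chi : galQ -> A) : Prop :=
  match tau with
  | Sc_m1_1_4 => sc_char (-1) 1 4 chi
  | Sc_m1_2_3 => sc_char (-1) 2 3 chi
  | Sc_m1_2_3_twist => exists psi, sc_char (-1) 2 3 psi /\
      forall s, quad_subgroup V (-1) s -> chi s = psi s * eps3 s
  | Sc_p3_2_6 => sc_char 3 2 6 chi
  | Sc_m3_2_6 => sc_char (-3) 2 6 chi
  | Sc_m3_4_6 j => sc_char (-3) 4 6 chi /\
      exists (rec : algC -> galQ) (xi6 : algC) (zeta3 : A),
      [/\ local_reciprocity V (quad_subgroup V (-3)) rec,
          6.-primitive_root xi6, 3.-primitive_root zeta3,
          chi (rec (- xi6)) = zeta3 ^+ j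
        & chi (rec (xi6 - 3)) = - exprz zeta3 (j%:Z - 1)]
  end.

End ScTypes.

(* rho, the l-adic Tate module representation of E, has the same restriction to
   inertia at V as Ind chi. *)
Definition has_inertial_type (A : idomainType) (k : fieldType)
    (red : {rmorphism A -> k}) (V : set algC) (rho : galQ -> 'M[A]_2)
    (tau : sc_type3) (chi : galQ -> A) : Prop :=
  inducing_char red V tau chi /\
  iso_ind_frac (decomp V) (quad_subgroup V (sc_disc tau)) (inertia V) rho chi.

(* dp_deforms red rho: rho is a deformation to A of the given kind.  The set S
   of places consists of infinity and of the members of dp_ramset. *)
Record deformation_problem (k : finFieldType) := DeformationProblem {
  dp_ramset : seq nat;
  dp_residual : galQ -> 'M[k]_2;
  dp_deforms : forall A : comUnitRingType,
    {rmorphism A -> k} -> (galQ -> 'M[A]_2) -> Prop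
}.

Definition is_deformation_problem (k : finFieldType) (D : deformation_problem k)
  : Prop :=
  [/\ all prime (dp_ramset D),
      galQS_rep (idfun : {rmorphism k -> k}) (dp_ramset D) (dp_residual D),
      forall (A : comUnitRingType) (red : {rmorphism A -> k}) rho,
        dp_deforms D red rho ->
        [/\ coefficient_ring red, galQS_rep red (dp_ramset D) rho
          & forall s, map_mx red (rho s) = dp_residual D s],
      forall (A : comUnitRingType) (red : {rmorphism A -> k}) rho (g : 'M[A]_2),
        dp_deforms D red rho -> map_mx red g = 1%:M ->
        dp_deforms D red (fun s => invmx g *m rho s *m g)
    & forall (A B : comUnitRingType) (redA : {rmorphism A -> k})
        (redB : {rmorphism B -> k}) (h : {rmorphism A -> B}) rho,
        (forall x, redB (h x) = redA x) -> coefficient_ring redB ->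
        dp_deforms D redA rho -> dp_deforms D redB (fun s => map_mx h (rho s))].

(* Minimal ramification at the primes p | N of supercuspidal type, where
   K = Q_p(sqrt d).  The characters take values in an extension k' of k, and so
   the deformations to A become induced over an extension A' of A with residue
   field k'. *)
Definition minimally_ramified (k k' : finFieldType) (iota : {rmorphism k -> k'})
    (O : idomainType) (red : {rmorphism O -> k'}) (N : nat)
    (rhoE : galQ -> 'M[O]_2) (D : deformation_problem k) : Prop :=
  forall p V (d : int) (chi : galQ -> O),
  let G := decomp V in
  let GK := quad_subgroup V d in
  let chibar := fun s => red (chi s) in
  p \in primes N -> is_place p V -> is_character red GK chi ->
  iso_ind_frac G GK G rhoE chi -> neq_conj G GK chi ->
  iso_ind G GK G (fun s => map_mx iota (dp_residual D s)) chibar ->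
  forall (A : comUnitRingType) (redA : {rmorphism A -> k}) rho,
  dp_deforms D redA rho ->
  exists (A' : comUnitRingType) (redA' : {rmorphism A' -> k'})
         (h : {rmorphism A -> A'}) (chiA : galQ -> A'),
  [/\ coefficient_ring redA', forall x, redA' (h x) = iota (redA x),
      is_character redA' GK chiA /\ (forall s, GK s -> redA' (chiA s) = chibar s),
      forall c, char_conductor V GK chibar c <-> char_conductor V GK chiA c
    & iso_ind G GK G (fun s => map_mx h (rho s)) chiA].

(* H^0(G, eps_l (x) ad^0 rho) *)
Definition H0_ad0 (k : fieldType) (l : nat) (rho : galQ -> 'M[k]_2)
    (G : set galQ) : set 'M[k]_2 :=
  [set X | \tr X = 0 /\
     forall s, G s -> cyclo k l s *: (rho s *m X *m invmx (rho s)) = X].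

(* V is a place above the prime in question *)
Definition local_obstruction (k : finFieldType) (l : nat)
    (D : deformation_problem k) (V : set algC) : Prop :=
  H0_ad0 l (dp_residual D) (decomp V) <> [set 0].
Definition locally_unobstructed (k : finFieldType) (l : nat)
    (D : deformation_problem k) (V : set algC) : Prop :=
  ~ local_obstruction l D V.

(* Main.v *)
Require Import Defs.
From HB Require Import structures.
From mathcomp Require Import all_boot all_order all_algebra all_field.
From mathcomp Require Import all_classical all_reals all_analysis.
From mathcomp Require Import complex ring.
Set Implicit Arguments.
Unset Strict Implicit.
Unset Printing Implicit Defensive.
Import Order.TTheory GRing.Theory Num.Theory.
Local Open Scope classical_set_scope.
Local Open Scope ring_scope.

(* Over k', conjugate an element of H^0(G_3, eps (x) ad^0 rhobar) to a 2 x 2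
   matrix Z such that eps(t) Ind(t) Z = Z Ind(t) for t in G_3; for t in G_K,
   Ind(t) is the diagonal matrix (chi(t), chi^s(t)).
   - If phi is a Frobenius at 3 then phi^2 lies in G_K and eps(phi^2) = 9 <> 1
     modulo l >= 5, so the diagonal of Z vanishes.
   - If Z has a nonzero off-diagonal entry then chi = chi^s on inertia, where
     eps is trivial.  As chi chi^s = det rhobar = eps on G_K, chi^2 would then
     be trivial on the inertia group of K.  But chi has order 3, 4 or 6 there,
     and this order is not changed by reduction modulo l >= 5.
   Frobenius elements at a place V of algC are obtained as follows.  Let m be
   the maximal ideal of V and B the ring of the numbers all of whose conjugates
   are in V.  For finitely many x_i in B, lying in a Galois extension L of Q,
   and q(T) = sum x_i T^i, the coefficients of prod_g (Y - (g q)(T)) are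
   rational numbers in V, hence equal to their p-th powers modulo m.  So
   Y = sum x_i^p T^i is a root modulo m, as q is a root, and some g in Gal(L/Q)
   satisfies g x_i = x_i^p modulo m for all i.  By compactness a single
   automorphism does so on B, and V is the localization of B at m. *)

(** * Valuation ring and maximal ideal of a place *)

Definition place_ring p V of is_place p V : {pred algC} := fun x => `[< V x >].

Lemma place_ringE p V (hV : is_place p V) x : reflect (V x) (x \in place_ring hV).
Proof. exact: asboolP. Qed.

Fact place_ring_subring p V (hV : is_place p V) :
  subring_closed (place_ring hV).
Proof.
have [V1 VB VM _ _] := hV; split; first exact/place_ringE.
- by move=> x y /place_ringE Vx /place_ringE Vy; apply/place_ringE/VB.
- by move=> x y /place_ringE Vx /place_ringE Vy; apply/place_ringE/VM.
Qed.
HB.instance Definition _ p V (hV : is_place p V) :=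
  GRing.isSubringClosed.Build algC (place_ring hV) (place_ring_subring hV).

(** As for [place_ring], the proof that [V] is a place is an argument of the predicate, so that
    closure structures can be attached to it. *)
Definition place_max p V of is_place p V : {pred algC} :=
  fun x => `[< place_ideal V x >].

Lemma place_maxE p V (hV : is_place p V) x :
  reflect (place_ideal V x) (x \in place_max hV).
Proof. exact: asboolP. Qed.

Section Place.
Variables (p : nat) (V : set algC) (hV : is_place p V).
Local Notation O := (place_ring hV).
Local Notation m := (place_max hV).

Lemma place_max_ring : {subset m <= O}.
Proof. by move=> x /place_maxE[/place_ringE]. Qed.

Lemma place_total x : x \in O \/ x^-1 \in O.
Proof. by have [_ _ _ /(_ x) [] /place_ringE] := hV; [left | right]. Qed.

Lemma place_unitE x : x \in O -> (x \in m) = ~~ ((x != 0) && (x^-1 \in O)).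
Proof.
move=> /place_ringE Vx; apply/place_maxE/idP => [[_ [->|nV]]|].
- by rewrite eqxx.
- by apply/negP => /andP[_ /place_ringE].
- by rewrite negb_and negbK => /orP[/eqP x0|/place_ringE nV]; split=> //; [left | right].
Qed.

Lemma place_one_notin_max : 1 \notin m.
Proof. by rewrite place_unitE ?rpred1 // oner_neq0 invr1 rpred1. Qed.


Lemma place_invr x : x \in O -> x \notin m -> x != 0 /\ x^-1 \in O.
Proof. by move=> Ox; rewrite place_unitE // negbK => /andP. Qed.

Lemma place_max_mull a x : a \in O -> x \in m -> a * x \in m.
Proof.
move=> Oa mx; have Ox := place_max_ring mx; apply: contraLR (mx) => nmax.
have [/[!mulf_eq0] /norP[a0 x0] Oax] := place_invr (rpredM Oa Ox) nmax.
rewrite place_unitE // x0 negbK /=.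
by rewrite -[x^-1](mulVKf a0) rpredM // -invfM.
Qed.

Lemma place_max_mulr a x : a \in O -> x \in m -> x * a \in m.
Proof. by rewrite mulrC; exact: place_max_mull. Qed.

Lemma place_maxM x y : x \in O -> y \in O -> x * y \in m ->
  x \in m \/ y \in m.
Proof.
move=> Ox Oy mxy; have [|nx] := boolP (x \in m); [by left | right].
have [x0 Ovx] := place_invr Ox nx.
by rewrite -[y](mulKf x0); exact: place_max_mull.
Qed.

(** If [x - y] were a unit, one of [x / y] and [y / x] would be integral, say [u / v]; then
    [v^-1 = (u / v - 1) / (u - v)] would be integral too, against [v] in [m]. The case [v = 0] is
    direct. *)
Fact place_max_zmod : zmod_closed m.
Proof.
have m0 : 0 \in m by rewrite place_unitE ?rpred0 // eqxx.
split=> // x y mx my; have Oxy := rpredB (place_max_ring mx) (place_max_ring my).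
apply: contraT => nmax; have [xy0 Oxyi] := place_invr Oxy nmax.
have key u v : u \in m -> v \in m -> u - v != 0 -> (u - v)^-1 \in O ->
    u / v \in O -> false.
  move=> mu mv uv0 Ouv Oq; have [v0|v0] := eqVneq v 0.
    move: Ouv uv0 (mu); rewrite v0 subr0 => Ov un0.
    by rewrite (place_unitE (place_max_ring mu)) un0 Ov.
  move: (mv); rewrite (place_unitE (place_max_ring mv)) v0 /= => /negP[].
  have -> : v^-1 = (u / v - 1) * (u - v)^-1.
    by rewrite -(mulfV v0) -mulrBl mulrAC mulfV // mul1r.
  by rewrite rpredM // rpredB // rpred1.
have [Oq|] := place_total (x / y); first exact: (key x y).
rewrite invf_div => Oq; apply: (key y x) => //; first by rewrite -opprB oppr_eq0.
by rewrite -opprB invrN rpredN.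
Qed.
HB.instance Definition _ := GRing.isZmodClosed.Build algC m place_max_zmod.

Lemma place_notin_ring x : x \notin O -> x^-1 \in m.
Proof.
move=> nO; have [|Ov] := place_total x; first by rewrite (negPf nO).
by rewrite place_unitE // invrK negb_and nO orbT.
Qed.

Lemma place_maxXn x n : x \in O -> x ^+ n \in m -> x \in m.
Proof.
move=> Ox; elim: n => [|n IH]; first by rewrite expr0 (negPf place_one_notin_max).
by rewrite exprS => /(place_maxM Ox (rpredX n Ox))[].
Qed.

Lemma place_max_expr x n : (0 < n)%N -> x \in m -> x ^+ n \in m.
Proof.
case: n => // n _ mx; rewrite exprS place_max_mulr //.
by rewrite rpredX ?place_max_ring.
Qed.

Lemma place_max_natp : p%:R \in m.
Proof.
rewrite place_unitE ?rpred_nat //; apply/negP => /andP[_ /place_ringE].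
by have [_ _ _ _] := hV.
Qed.

(** When [p] does not divide [n], a Bezout relation between them would put 1 in [m]. *)
Lemma place_max_nat n : prime p -> (n%:R \in m) = (p %| n)%N.
Proof.
move=> p_pr; apply/idP/idP => [mn|/dvdnP[k ->]]; last first.
  by rewrite natrM place_max_mull ?place_max_natp ?rpred_nat.
apply: contraNT place_one_notin_max; rewrite -prime_coprime // => cop.
have [k l e _] := egcdnP n (prime_gt0 p_pr); move: e; rewrite (eqP cop) => e.
have -> : 1 = k%:R * p%:R - l%:R * n%:R :> algC.
  by rewrite -!natrM e natrD addrAC subrr add0r.
by rewrite rpredB // place_max_mull ?rpred_nat ?place_max_natp.
Qed.

(** If [z] were not integral, [z^-1] would be in [m], and so would its [n]-th power 1. *)
Lemma place_ring_unity_root n z : (0 < n)%N -> z ^+ n = 1 -> z \in O.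
Proof.
move=> n0 zn1; apply: contraT => nO; apply: contraNT place_one_notin_max => _.
rewrite -invr1 -zn1 -exprVn -(prednK n0) exprS.
by rewrite place_max_mulr ?rpredX ?place_max_ring ?place_notin_ring.
Qed.

(* If w = x / y <> 1 then the sum of the w ^+ i, i < n, is 0; it is also
   congruent to n, which is a unit. *)
Lemma place_unity_root_inj n x y : prime p -> ~~ (p %| n)%N -> (0 < n)%N ->
  x ^+ n = 1 -> y ^+ n = 1 -> x - y \in m -> x = y.
Proof.
move=> p_pr pn n0 xn1 yn1 mxy.
have y0 : y != 0.
  apply: contraTneq (oner_neq0 algC) => y0.
  by rewrite -yn1 y0 expr0n gtn_eqF //= eqxx.
pose w := x / y; have wn1 : w ^+ n = 1 by rewrite expr_div_n xn1 yn1 divr1.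
have Ow := place_ring_unity_root n0 wn1.
have mw : w - 1 \in m.
  have -> : w - 1 = (x - y) / y by rewrite mulrBl mulfV.
  rewrite place_max_mulr //; apply: (place_ring_unity_root n0).
  by rewrite exprVn yn1 invr1.
suff /eqP : w = 1 by rewrite -subr_eq0 -(inj_eq (mulIf y0)) mul0r mulrBl mul1r
   divfK // subr_eq0 => /eqP.
apply/eqP; apply: contraNT pn => w1; rewrite -place_max_nat //.
have sum0 : \sum_(i < n) w ^+ i = 0.
  apply: (mulfI (_ : w - 1 != 0)); first by rewrite subr_eq0.
  by rewrite mulr0 -subrX1 wn1 subrr.
have -> : n%:R = - \sum_(i < n) (w ^+ i - 1).
  by rewrite sumrB sum0 sumr_const card_ord sub0r opprK.
rewrite rpredN rpred_sum // => i _; rewrite subrX1 place_max_mulr //.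
by rewrite rpred_sum // => j _; rewrite rpredX.
Qed.

End Place.

(** * Numbers all of whose conjugates are integral at the place *)

Lemma conj_finite (x : algC) : exists ys : seq algC, forall s : galQ, s x \in ys.
Proof.
have [r Dr] := closed_field_poly_normal (minCpoly x).
exists r => s; rewrite -root_prod_XsubC.
have := root_minCpoly (s x); rewrite minCpoly_aut Dr.
by rewrite (monicP (minCpoly_monic x)) scale1r.
Qed.

Definition conj_ring p V of is_place p V : {pred algC} :=
  fun x => `[< forall s : galQ, V (s x) >].

Section ConjugateRing.
Variables (p : nat) (V : set algC) (hV : is_place p V).
Local Notation O := (place_ring hV).
Local Notation m := (place_max hV).
Local Notation B := (conj_ring hV).

Lemma conj_ringE x : reflect (forall s : galQ, s x \in O) (x \in B).
Proof.
by apply: (iffP (asboolP _)) => + s => /(_ s); [move/place_ringE | move=> /place_ringE].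
Qed.

Lemma conj_ring_gal (s : galQ) x : x \in B -> s x \in B.
Proof. by move=> /conj_ringE Bx; apply/conj_ringE => t; exact: (Bx (t \o s)). Qed.

Lemma conj_ring_place x : x \in B -> x \in O.
Proof. by move=> /conj_ringE/(_ gid). Qed.

(* The numbers y * euclid_prod n y + 1 are built as in Euclid's proof that there
   are infinitely many primes, so that at most one of them is in m. *)
Fixpoint euclid_prod (n : nat) (y : algC) : algC :=
  if n is k.+1 then euclid_prod k y * (y * euclid_prod k y + 1) else 1.
Definition euclid_next n y := y * euclid_prod n y + 1.

Lemma euclid_next_gal (s : galQ) n y : s (euclid_next n y) = euclid_next n (s y).
Proof.
have prodE k : s (euclid_prod k y) = euclid_prod k (s y).
  by elim: k => [|k IH] /=; rewrite ?rmorph1 // rmorphM rmorphD rmorphM rmorph1 IH.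
by rewrite /euclid_next rmorphD rmorphM rmorph1 prodE.
Qed.

Lemma euclid_prod_ring n y : y \in O -> euclid_prod n y \in O.
Proof.
move=> Oy; elim: n => [|n IH] /=; first exact: rpred1.
by rewrite rpredM // rpredD ?rpred1 ?rpredM.
Qed.

Lemma euclid_next_ring n y : y \in O -> euclid_next n y \in O.
Proof. by move=> Oy; rewrite rpredD ?rpred1 ?rpredM ?euclid_prod_ring. Qed.

(** For [i < j], [euclid_next i y] is a factor of [euclid_prod j y]; if both numbers were in [m], so
    would be [1 = euclid_next j y - y * euclid_prod j y]. *)
Lemma euclid_next_inj i j y : y \in O ->
  euclid_next i y \in m -> euclid_next j y \in m -> i = j.
Proof.
move=> Oy; wlog: i j / (i < j)%N => [H mi mj|ij mi mj].
  by case: (ltngtP i j) => // ij; [exact: H | symmetry; exact: H].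
have mprod : euclid_prod j y \in m.
  elim: j ij {mj} => // j IH /=; rewrite ltnS leq_eqVlt => /predU1P[<-|ij].
    by rewrite place_max_mull ?euclid_prod_ring.
  by rewrite place_max_mulr ?IH ?euclid_next_ring.
case/negP: (place_one_notin_max hV).
rewrite (_ : 1 = euclid_next j y - y * euclid_prod j y) ?rpredB //.
  exact: place_max_mull.
by rewrite /euclid_next addrC addKr.
Qed.

(** The pole of [y] dominates: for [w] with integral inverse, [y * w + 1 = y * w * (1 + u)] where
    [u = (y * w)^-1] is in [m], so that [1 + u] is a unit. *)
Lemma euclid_next_inv n y : y \notin O ->
  (euclid_next n y)^-1 \in m /\ y / euclid_next n y \in O.
Proof.
move=> nOy; have y0 : y != 0 by apply: contraNneq nOy => ->; exact: rpred0.
have key w : w != 0 -> w^-1 \in O ->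
    [/\ y * w + 1 != 0, (y * w + 1)^-1 \in m & y / (y * w + 1) \in O].
  move=> w0 Ow; pose u := (y * w)^-1.
  have mu : u \in m.
    by rewrite /u invfM place_max_mulr // place_notin_ring.
  have Ou1 : 1 + u \in O by rewrite rpredD ?rpred1 ?place_max_ring.
  have nmu1 : 1 + u \notin m.
    by apply: contra (place_one_notin_max hV) => mu1; rewrite -(addrK u 1) rpredB.
  have [u10 Ou1V] := place_invr Ou1 nmu1.
  have -> : y * w + 1 = y * w * (1 + u) by rewrite mulrDr mulr1 mulfV ?mulf_neq0.
  rewrite !mulf_neq0 // [in X in X \in m]invfM place_max_mulr //; split=> //.
  by rewrite !invfM !mulrA mulfV // mul1r rpredM.
have [w0 Ow] : euclid_prod n y != 0 /\ (euclid_prod n y)^-1 \in O.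
  elim: n => [|n [w0 Ow]] /=; first by rewrite oner_neq0 invr1 rpred1.
  have [h0 mh _] := key _ w0 Ow.
  by rewrite mulf_neq0 // invfM rpredM // place_max_ring.
by have [] := key _ w0 Ow.
Qed.

(** The fraction is [(x / h) / h^-1] with [h = euclid_next n x]. For a suitable [n], a conjugate of
    [h] is a unit where the conjugate of [x] is integral, and it has a pole elsewhere; so both terms
    are in [B]. *)
Lemma place_frac x : x \in O ->
  exists a b, [/\ a \in B, b \in B, b \notin m & x = a / b].
Proof.
move=> Ox; have [ys conj_ys] := conj_finite x.
(* Pigeonhole: each integral conjugate excludes at most one [n], so one of the first [size ys + 1]
   indices is good. *)
have [n good] : exists n, forall y, y \in ys -> y \in O -> euclid_next n y \notin m.
  apply: contrapT => none.
  have bad n : exists y, [&& y \in ys, y \in O & euclid_next n y \in m].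
    apply: contrapT => nbad; apply: none; exists n => y ysy Oy.
    by apply/negP => mh; apply: nbad; exists y; rewrite ysy Oy.
  pose f n := xchoose (bad n); have fP n : [&& _, _ & _] := xchooseP (bad n).
  have f_inj : injective f.
    move=> i j eij; have /and3P[_ Oy mi] := fP i; have /and3P[_ _ mj] := fP j.
    by apply: (euclid_next_inj Oy mi); rewrite -/(f i) eij.
  have : (size (map f (iota 0 (size ys).+1)) <= size ys)%N.
    apply: uniq_leq_size; first by rewrite map_inj_uniq ?iota_uniq.
    by move=> _ /mapP[i _ ->]; have /and3P[] := fP i.
  by rewrite size_map size_iota ltnn.
pose h := euclid_next n x.
have invB (s : galQ) : (s h)^-1 \in O /\ s x / s h \in O.
  rewrite euclid_next_gal; have [Osx|nOsx] := boolP (s x \in O).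
    have [_ Oh] := place_invr (euclid_next_ring n Osx) (good _ (conj_ys s) Osx).
    by rewrite rpredM.
  by have [/place_max_ring] := euclid_next_inv n nOsx.
have [h0 _] := place_invr (euclid_next_ring n Ox) (good _ (conj_ys gid) Ox).
exists (x / h), h^-1; split.
- by apply/conj_ringE => s; rewrite fmorph_div; have [] := invB s.
- by apply/conj_ringE => s; rewrite fmorphV; have [] := invB s.
- have [Oh _] := invB gid; rewrite place_unitE // negbK invr_eq0 h0 invrK.
  exact: euclid_next_ring.
- by rewrite invrK divfK.
Qed.

End ConjugateRing.

(** * Polynomials over the valuation ring and the p-th power map *)

Lemma exprD_prime (R : comNzRingType) (S : subringClosed R) p x y :
  prime p -> x \in S -> y \in S ->
  exists2 w, w \in S & (x + y) ^+ p = x ^+ p + y ^+ p + p%:R * w.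
Proof.
case: p => // p p_pr Sx Sy.
(* These are the middle terms of the binomial expansion, the prime being taken out of each
   coefficient. *)
exists (\sum_(i < p) (x ^+ (p - i) * y ^+ i.+1) *+ ('C(p.+1, i.+1) %/ p.+1)).
  by rewrite rpred_sum // => i _; rewrite rpredMn // rpredM // rpredX.
rewrite exprDn big_ord_recl big_ord_recr /= subn0 subnn bin0 binn !expr0 !mulr1.
rewrite mul1r !mulr1n -addrA [_ + y ^+ _]addrC; congr (_ + (_ + _)).
rewrite mulr_sumr; apply: eq_bigr => i _; rewrite /bump /= add1n subSS mulr_natl.
by rewrite -mulrnA divnK // prime_dvd_bin //= ltnS ltn_ord.
Qed.

Section PolyOverPlace.
Variables (p : nat) (V : set algC) (hV : is_place p V).
Hypothesis p_pr : prime p.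
Local Notation O := (place_ring hV).
Local Notation m := (place_max hV).

Lemma polyOver_max_mull f g :
  f \is a polyOver O -> g \is a polyOver m -> f * g \is a polyOver m.
Proof.
move=> /polyOverP Of /polyOverP mg; apply/polyOverP => k; rewrite coefM.
by rewrite rpred_sum // => i _; exact: place_max_mull.
Qed.

(** Gauss's lemma: if the lowest coefficients of [f] and [g] outside [m] are at [i] and [j], the
    coefficient of [f * g] at [i + j] is their product modulo [m]. *)
Lemma polyOver_maxM f g : f \is a polyOver O -> g \is a polyOver O ->
  f * g \is a polyOver m -> f \is a polyOver m \/ g \is a polyOver m.
Proof.
move=> /polyOverP Of /polyOverP Og /polyOverP mfg; apply: contrapT => nfg.
have low h : ~ (h \is a polyOver m) ->
    exists i, h`_i \notin m /\ forall j, (j < i)%N -> h`_j \in m.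
  move=> nh; have ex : exists i, h`_i \notin m.
    by apply: contrapT => all_m; apply: nh; apply/polyOverP => i;
      apply/negPn/negP => hi; apply: all_m; exists i.
  case: (ex_minnP ex) => i hi min_i; exists i; split=> // j ji.
  by apply: contraLR ji => /min_i; rewrite -leqNgt.
have [i [fi flt]] := low f (fun mf => nfg (or_introl mf)).
have [j [gj glt]] := low g (fun mg => nfg (or_intror mg)).
have := mfg (i + j)%N; rewrite coefM.
have lt_i : (i < (i + j).+1)%N by rewrite ltnS leq_addr.
rewrite (bigD1 (Ordinal lt_i)) //= addKn rpredDr; last first.
  rewrite rpred_sum // => k /negP ki; have [ki'|ik|] := ltngtP k i.
  - by rewrite place_max_mulr ?flt.
  - by rewrite place_max_mull ?glt // ltn_subLR ?ltn_add2r // -ltnS.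
  - by move=> ki'; case: ki; apply/eqP/val_inj.
by move=> /(place_maxM (Of i) (Og j)) []; apply/negP.
Qed.

Lemma polyOver_max_prod (I : finType) (P : pred I) (F : I -> {poly algC}) :
  (forall i, P i -> F i \is a polyOver O) ->
  \prod_(i | P i) F i \is a polyOver m -> exists2 i, P i & F i \is a polyOver m.
Proof.
move=> OF; apply: contraPP => nF.
(* Integrality is carried through the induction because Gauss's lemma asks for it. *)
suff : \prod_(i | P i) F i \is a polyOver O /\
    ~ (\prod_(i | P i) F i \is a polyOver m) by case.
apply: (big_ind (fun f => f \is a polyOver O /\ ~ (f \is a polyOver m))).
- split; first exact: rpred1.
  move/polyOverP/(_ 0%N); rewrite coef1 eqxx; apply/negP.
  exact: place_one_notin_max.
- move=> f g [Of nf] [Og ng]; split; first exact: rpredM.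
  by move/(polyOver_maxM Of Og) => [].
- by move=> i Pi; split; [exact: OF | move=> mF; apply: nF; exists i].
Qed.

(* Says that b is the image of a under the p-th power map on coefficients,
   modulo m: a ^ p = b(X^p). *)
Definition frob_rel (a b : {poly algC}) : Prop :=
  [/\ a \is a polyOver O, b \is a polyOver O
    & a ^+ p - (b \Po 'X^p) \is a polyOver m].

Lemma frob_rel0 : frob_rel 0 0.
Proof.
by split; rewrite ?rpred0 // comp_poly0 subr0 expr0n gtn_eqF ?prime_gt0 ?rpred0.
Qed.

Lemma frob_relD a b a' b' :
  frob_rel a b -> frob_rel a' b' -> frob_rel (a + a') (b + b').
Proof.
move=> [Oa Ob mab] [Oa' Ob' mab']; split; [exact: rpredD | exact: rpredD |].
have [w Ow ->] := exprD_prime p_pr Oa Oa'.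
rewrite comp_polyD.
have -> : a ^+ p + a' ^+ p + p%:R * w - ((b \Po 'X^p) + (b' \Po 'X^p)) =
    (a ^+ p - (b \Po 'X^p)) + (a' ^+ p - (b' \Po 'X^p)) + p%:R * w by ring.
rewrite rpredD //; first exact: rpredD.
rewrite mulrC polyOver_max_mull //; apply/polyOverP => i; rewrite -polyC_natr coefC.
by case: ifP; rewrite ?rpred0 // place_max_natp.
Qed.

Lemma frob_relM a b a' b' :
  frob_rel a b -> frob_rel a' b' -> frob_rel (a * a') (b * b').
Proof.
move=> [Oa Ob mab] [Oa' Ob' mab']; split; [exact: rpredM | exact: rpredM |].
rewrite exprMn comp_polyM.
have -> : a ^+ p * a' ^+ p - (b \Po 'X^p) * (b' \Po 'X^p) =
    a ^+ p * (a' ^+ p - (b' \Po 'X^p)) + (b' \Po 'X^p) * (a ^+ p - (b \Po 'X^p)).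
  by ring.
by rewrite rpredD // polyOver_max_mull ?rpredX ?polyOver_comp // polyOverXn.
Qed.

Lemma frob_relX a b n : frob_rel a b -> frob_rel (a ^+ n) (b ^+ n).
Proof.
move=> Rab; elim: n => [|n IH]; last by rewrite !exprS; exact: frob_relM.
by split; rewrite ?expr0 ?rpred1 // expr1n comp_polyC subrr rpred0.
Qed.

Lemma frob_rel_sum n (a b : nat -> {poly algC}) :
  (forall i, frob_rel (a i) (b i)) ->
  frob_rel (\sum_(i < n) a i) (\sum_(i < n) b i).
Proof.
move=> Rab; elim: n => [|n IH]; first by rewrite !big_ord0; exact: frob_rel0.
by rewrite !big_ord_recr; exact: frob_relD.
Qed.

Lemma frob_rel_poly n (a b : nat -> algC) :
  (forall i, a i \in O) -> (forall i, a i ^+ p - b i \in m) ->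
  frob_rel (\poly_(i < n) a i) (\poly_(i < n) b i).
Proof.
move=> Oa mab; rewrite !poly_def.
apply: (@frob_rel_sum n (fun i => a i *: 'X^i) (fun i => b i *: 'X^i)) => i.
have Ob : b i \in O.
  rewrite -[b i](subKr (a i ^+ p)).
  by apply: rpredB; [exact: rpredX | exact: place_max_ring].
split; [by rewrite polyOverZ ?polyOverXn | by rewrite polyOverZ ?polyOverXn |].
rewrite exprZn comp_polyZ comp_Xn_poly exprAC -scalerBl.
apply/polyOverP => j; rewrite coefZ place_max_mulr //.
by rewrite -exprM coefXn rpred_nat.
Qed.

(** The coefficient of [b(X^p)] at [i * p] is the [i]-th coefficient of [b]. *)
Lemma frob_rel_zero b : frob_rel 0 b -> b \is a polyOver m.
Proof.
have p_gt0 := prime_gt0 p_pr.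
move=> [_ _]; rewrite expr0n gtn_eqF // sub0r rpredN => /polyOverP mb.
apply/polyOverP => i; have := mb (i * p)%N.
by rewrite coef_comp_poly_Xn // dvdn_mull // mulnK.
Qed.

(** If the p-th power map fixes the coefficients of [F] modulo [m], it carries a root of [F] to a
    root modulo [m]. *)
Lemma frob_rel_horner (F : {poly {poly algC}}) a b :
  (forall j, frob_rel F`_j F`_j) -> frob_rel a b -> frob_rel F.[a] F.[b].
Proof.
move=> RF Rab; rewrite !horner_coef.
apply: (@frob_rel_sum _ (fun i => F`_i * a ^+ i) (fun i => F`_i * b ^+ i)) => i.
by apply: frob_relM => //; exact: frob_relX.
Qed.

Lemma place_max_fermat_int (z : int) : z%:~R ^+ p - z%:~R \in m.
Proof.
have nat_case (n : nat) : n%:R ^+ p - n%:R \in m.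
  have n_le : (n <= n ^ p)%N.
    case: n => // n; rewrite -{1}(expn1 n.+1) leq_pexp2l // prime_gt0 //.
  rewrite -natrX -natrB // place_max_nat // -eqn_mod_dvd //.
  by apply/eqP; rewrite fermat_little.
have [|n|n] := intP z; first exact: (nat_case 0%N).
- exact: nat_case.
rewrite rmorphN /= -pmulrn opprK exprNn.
(* For odd [p] the sign passes through the power; for [p = 2] the discrepancy is a multiple of 2,
   hence in [m]. *)
have [p2|p_odd] := even_prime p_pr.
  have -> : (-1) ^+ p = 1 :> algC by rewrite -signr_odd p2.
  have -> : 1 * n.+1%:R ^+ p + n.+1%:R =
      n.+1%:R ^+ p - n.+1%:R + n.+1%:R * 2%:R :> algC by ring.
  by rewrite rpredD // place_max_mull ?rpred_nat // place_max_nat // p2.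
by rewrite -signr_odd p_odd expr1 mulN1r addrC -opprB rpredN.
Qed.

(** In lowest terms the denominator is not in [m]: otherwise the numerator would be as well, and [p]
    would divide both. So Fermat's congruence passes from integers to the quotient. *)
Lemma place_max_fermat_rat (c : algC) : c \in Crat -> c \in O ->
  c ^+ p - c \in m.
Proof.
move=> /CratP[q ->] Oc.
have intr_max (z : int) : (z%:~R \in m) = (p %| `|z|)%N.
  case: (intP z) => [|n|n]; first by rewrite rpred0 dvdn0.
    by rewrite -pmulrn place_max_nat.
  by rewrite mulrNz rpredN abszN -pmulrn place_max_nat.
have Oint (z : int) : z%:~R \in O by exact: rpred_int.
have d0 : (denq q)%:~R != 0 :> algC by rewrite intr_eq0 denq_neq0.
have qE : ratr q = (numq q)%:~R / (denq q)%:~R :> algC.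
  by rewrite -{1}(divq_num_den q) fmorph_div; congr (_ / _); exact: ratr_int.
have nmd : (denq q)%:~R \notin m.
  rewrite intr_max; apply/negP => pd.
  have : (numq q)%:~R \in m.
    by rewrite -[X in X \in _](divfK d0) -qE place_max_mull ?intr_max.
  rewrite intr_max => pn; have := coprime_num_den q; rewrite /coprime => /eqP cop.
  by have := dvdn_gcd p `|numq q| `|denq q|; rewrite pn pd cop dvdn1 => /eqP p1;
    move: p_pr; rewrite p1.
have [_ Odi] := place_invr (Oint _) nmd.
set n := (numq q)%:~R in qE; set d := (denq q)%:~R in qE nmd d0 Odi.
have -> : ratr q ^+ p - ratr q =
    ((n ^+ p - n) * d - n * (d ^+ p - d)) * (d^-1 ^+ p * d^-1).
  rewrite qE expr_div_n exprVn; field.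
  by rewrite d0 expf_neq0.
rewrite place_max_mulr ?rpredM ?rpredX // rpredB //.
  by rewrite place_max_mulr ?place_max_fermat_int ?Oint.
by rewrite place_max_mull ?place_max_fermat_int ?Oint.
Qed.

End PolyOverPlace.

(** * Existence of a Frobenius automorphism at a place *)

Lemma galois_field_exists (xs : seq algC) :
  exists (L : splittingFieldType rat) (iL : {rmorphism L -> algC}),
    galois 1 {:L} /\ exists ys, map iL ys = xs.
Proof.

pose minq x := s2val (minCpolyP x).
have minqE x : minCpoly x = map_poly ratr (minq x).
  by rewrite /minq; case: (minCpolyP x) => q [].
(* The field is the splitting field of this product, and separability comes from characteristic
   0. *)
pose f := \prod_(x <- xs) minq x.
have f_monic : f \is monic.
  apply: monic_prod => x _.
  by rewrite -(map_monic (ratr : {rmorphism rat -> algC})) -minqE minCpoly_monic.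
pose fC : {poly algC} := map_poly ratr f.
have [r Dr] := closed_field_poly_normal fC.
rewrite (monicP _) ?map_monic // scale1r in Dr.
have [L0 [iL [rL DrL genL]]] := num_field_exists r.
pose fL : {poly L0} := map_poly (in_alg L0) f.
have split_f : splittingFieldFor 1 fL {:L0}.
  exists rL => //; suff -> : fL = \prod_(z <- rL) ('X - z%:P) by exact: eqpxx.
  apply: (map_poly_inj iL).
  rewrite rmorph_prod -map_poly_comp (_ : map_poly _ f = fC).
    rewrite Dr -DrL big_map; apply: eq_bigr => z _.
    by rewrite /= map_polyXsubC.
  by apply: eq_map_poly => a /=; rewrite alg_num_field fmorph_rat.
have fL_Q : fL \is a polyOver 1%VS.
  by apply/polyOverP => i; rewrite coef_map /= rpredZ // mem1v.
pose spl := FieldExt_isSplittingField.Build rat L0 (ex_intro2 _ _ fL fL_Q split_f).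
pose L : splittingFieldType rat := HB.pack L0 spl.
exists L, iL; split.
  apply/and3P; split; first exact: sub1v.
    apply/separableP => y _; apply/negPn/negP => /separablePn_pchar[l].
    by rewrite pchar_lalg pchar_num.
  apply/splitting_normalField; first exact: sub1v.
  by exists fL.
have /(_ _ _)/sigW inL x : x \in xs -> exists y, iL y == x.
  move=> xs_x; have : x \in r.
    rewrite -root_prod_XsubC -Dr /fC rmorph_prod.
    rewrite (big_rem x) //= rootM -minqE root_minCpoly //.
  by rewrite -DrL => /mapP[y _ ->]; exists y.
pose preim x := oapp (fun u : {x | x \in xs} => sval (inL _ (valP u))) 0 (insub x).
exists (map preim xs).
rewrite -map_comp -[RHS]map_id; apply/eq_in_map => x xs_x /=.
by rewrite /preim insubT /=; case: (inL _ _) => y /= /eqP.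
Qed.

Section Frobenius.
Variables (p : nat) (V : set algC) (hV : is_place p V).
Hypothesis p_pr : prime p.
Local Notation O := (place_ring hV).
Local Notation m := (place_max hV).
Local Notation B := (conj_ring hV).

Lemma frobenius_finite (xs : seq algC) : {subset xs <= B} ->
  exists s : galQ, {in xs, forall x, s x - x ^+ p \in m}.
Proof.
move=> xsB; have [L [iL [galL [ys Dys]]]] := galois_field_exists xs.
have ext (g : gal_of {:L}) : {s : galQ | forall y, s (iL y) = iL (g y)}.
  by have [s Ds] := extend_algC_subfield_aut iL g; exists s => y; rewrite Ds.
have OL (g : gal_of {:L}) i : iL (g ys`_i) \in O.
  have [s <-] := ext g; apply: conj_ring_place; apply: conj_ring_gal.
  have [ltiy|leyi] := ltnP i (size ys); last first.
    by rewrite nth_default // rmorph0; apply/conj_ringE => t; rewrite rmorph0 rpred0.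
  by apply: xsB; rewrite -Dys -(nth_map 0 0) // mem_nth // size_map.
(* The indeterminate keeps the [x_i] apart, so that a single automorphism will serve for all of
   them. *)
pose n := size ys; pose q : {poly L} := \poly_(i < n) ys`_i.
pose qC (g : gal_of {:L}) : {poly algC} := \poly_(i < n) iL (g ys`_i).
have qCE (g : gal_of {:L}) : map_poly iL (map_poly g q) = qC g.
  apply/polyP => i; rewrite !coef_map !coef_poly /=.
  by case: ifP; rewrite ?rmorph0.
have OqC (g : gal_of {:L}) : qC g \is a polyOver O.
  by apply: polyOver_poly => i _; exact: OL.
pose FL : {poly {poly L}} := \prod_(g : gal_of {:L}) ('X - (map_poly g q)%:P).
pose F : {poly {poly algC}} := map_poly (map_poly iL) FL.
have FE : F = \prod_(g : gal_of {:L}) ('X - (qC g)%:P).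
  rewrite /F rmorph_prod; apply: eq_bigr => g _ /=.
  by rewrite map_polyXsubC /= qCE.
have FO j : F`_j \is a polyOver O.
  rewrite FE; move: j.
  pose K (f : {poly {poly algC}}) := forall j, f`_j \is a polyOver O.
  apply: (big_ind K) => /=.
  - by move=> j; rewrite coef1 rpred_nat.
  - by move=> f g Of Og j; rewrite coefM rpred_sum // => i _; rewrite rpredM.
  - move=> g _ j; rewrite coefB coefX coefC rpredB ?rpred_nat //.
    by case: ifP; rewrite ?rpred0.
have FQ j i : F`_j`_i \in Crat.
  rewrite !coef_map /=.
  suff : FL`_j`_i \in 1%VS.
    by move=> /vlineP[a ->]; rewrite alg_num_field fmorph_rat Crat_rat.
  rewrite -(galois_fixedField galL); apply/fixedFieldP; first exact: memvf.
  move=> h _.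
  (* An automorphism [h] permutes the factors of [FL]. *)
  suff Fh : map_poly (map_poly h) FL = FL by rewrite -{2}Fh !coef_map.
  rewrite rmorph_prod (reindex_inj (mulIg h^-1%g)); apply: eq_bigr => g _ /=.
  rewrite map_polyXsubC /=; congr ('X - _%:P).
  apply/polyP => k; rewrite !coef_map /=.
  by rewrite -galM ?memvf // mulgVK.
(* The expected root modulo [m]: the image of [q] under p-th powers of coefficients. *)
pose P : {poly algC} := \poly_(i < n) (iL ys`_i) ^+ p.
have RF j : frob_rel hV F`_j F`_j.
  rewrite -[X in frob_rel _ X _]coefK -[X in frob_rel _ _ X]coefK.
  apply: frob_rel_poly => // i; first exact/polyOverP/FO.
  by apply: place_max_fermat_rat => //; exact/polyOverP/FO.
have RP : frob_rel hV (qC 1%g) P.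
  pose u i := iL ((1%g : gal_of {:L}) ys`_i).
  apply: (@frob_rel_poly _ _ hV p_pr n u (fun i => iL ys`_i ^+ p)) => i.
    exact: OL.
  by rewrite /u gal_id subrr rpred0.
have := frob_rel_horner p_pr RF RP.
(* The factor of the identity automorphism vanishes at [qC 1], hence [F] at [P] is zero modulo
   [m]. *)
have -> : F.[qC 1%g] = 0.
  by rewrite FE (bigD1 (1%g : gal_of {:L})) //= hornerM hornerXsubC subrr mul0r.
move/(frob_rel_zero p_pr); rewrite FE horner_prod => mP.
have OP : P \is a polyOver O by have [] := RP.
(* By Gauss's lemma some factor [P - qC g] is zero modulo [m]; its coefficients are the required
   congruences. *)
have [g _] : exists2 g : gal_of {:L}, true & ('X - (qC g)%:P).[P] \is a polyOver m.
  by apply: polyOver_max_prod mP => g _; rewrite hornerXsubC rpredB.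
rewrite hornerXsubC => /polyOverP mPg; have [s Ds] := ext g; exists s.
move=> _ /(nthP 0)[i + <-]; rewrite -Dys size_map => lti.
have := mPg i; rewrite coefB !coef_poly lti (nth_map 0) // Ds.
by rewrite -rpredN opprB.
Qed.

End Frobenius.

(* The limit is taken along an ultrafilter on the finite sets of algebraic
   numbers, each of which has only finitely many conjugates. *)
Lemma galois_compact (T : seq algC -> galQ) :
  exists s : galQ, forall xs : seq algC, exists ys : seq algC, {subset xs <= ys} /\
    {in xs, T ys =1 s}.
Proof.
pose F0 : set_system (seq algC) :=
  [set A | exists xs : seq algC, forall ys : seq algC, {subset xs <= ys} -> A ys].
have F0_proper : ProperFilter F0.
  split; first by move=> [xs /(_ xs)]; apply.
  split=> [|A A' [xs Axs] [xs' Axs']|A A' AA' [xs Axs]].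
  - by exists [::].
  - exists (xs ++ xs') => ys sub; split.
      by apply: Axs => x xsx; apply: sub; rewrite mem_cat xsx.
    by apply: Axs' => x xsx; apply: sub; rewrite mem_cat xsx orbT.
  - by exists xs => ys /Axs/AA'.
have [U [U_ultra F0U]] := ultraFilterLemma F0_proper.
(* The values at [x] lie in a finite set, so the ultrafilter singles out one of them. *)
have lim x : exists y, U [set ys | T ys x = y].
  have [rs conj_rs] := conj_finite x.
  have : U [set ys | T ys x \in rs] by apply: F0U; exists [::] => ys _ /=.
  elim: rs {conj_rs} => [|r rs IH] Urs.
    by have [ys] := filter_ex Urs.
  have [Ur|nUr] := in_ultra_setVsetC [set ys | T ys x = r] U_ultra.
    by exists r.
  apply: IH; apply: filterS2 Urs nUr => ys /=.
  by rewrite inE => /predU1P[].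
pose f x := projT1 (cid (lim x)).
have fP x : U [set ys | T ys x = f x] := projT2 (cid (lim x)).
(* Finitely many values of [f] are taken simultaneously by some [T ys], which is a morphism. *)
have fB : zmod_morphism f.
  move=> x y; have [ys [[/= <- <-] <-]] :=
    filter_ex (filterI (filterI (fP x) (fP y)) (fP (x - y))).
  exact: rmorphB.
have fM : monoid_morphism f.
  split; first by have [ys /= <-] := filter_ex (fP 1); exact: rmorph1.
  move=> x y; have [ys [[/= <- <-] <-]] :=
    filter_ex (filterI (filterI (fP x) (fP y)) (fP (x * y))).
  exact: rmorphM.
pose fA := GRing.isZmodMorphism.Build _ _ f fB.
pose fMM := GRing.isMonoidMorphism.Build _ _ f fM.
pose s : galQ := HB.pack f fA fMM.
exists s => xs.
have Uxs : U [set ys | {in xs, T ys =1 s}].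
  elim: xs => [|x xs IH]; first by apply: filterS filterT => ys _ y.
  apply: filterS2 (fP x) IH => ys /= Tx Txs y; rewrite inE => /predU1P[->|] //.
  exact: Txs.
have Usub : U [set ys : seq algC | {subset xs <= ys}] by apply: F0U; exists xs.
by have [ys []] := filter_ex (filterI Usub Uxs); exists ys.
Qed.

Lemma exists_frobenius p V : prime p -> is_place p V ->
  exists s, is_frob V p s.
Proof.
move=> p_pr hV.
pose B := conj_ring hV; pose m := place_max hV; pose O := place_ring hV.
(* Entries outside [B] are discarded, since [T] has to be defined on all lists. *)
have local_frob ys : exists s : galQ,
    {in [seq y <- ys | y \in B], forall x, s x - x ^+ p \in m}.
  by apply: frobenius_finite => // x; rewrite mem_filter => /andP[].
pose T ys := projT1 (cid (local_frob ys)).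
have [s sP] := galois_compact T.
have frobB x : x \in B -> s x - x ^+ p \in m.
  move=> Bx; have [ys [sub <-]] := sP [:: x]; last by rewrite inE.
  apply: (projT2 (cid (local_frob ys))).
  by rewrite mem_filter Bx sub ?inE.
have sBO x : x \in B -> s x \in O.
  by move=> Bx; apply: conj_ring_place; exact: conj_ring_gal.
have unitB b : b \in B -> b \notin m ->
    [/\ b != 0, b^-1 \in O, s b \notin m & (s b)^-1 \in O].
  move=> Bb nmb; have Ob := conj_ring_place Bb; have [b0 Obi] := place_invr Ob nmb.
  (* Otherwise [b ^+ p = s b - (s b - b ^+ p)] would be in [m], and so would [b]. *)
  have nmsb : s b \notin m.
    apply: contra nmb => msb; apply: (@place_maxXn _ _ _ _ p) => //.
    by rewrite -[_ ^+ _](subKr (s b)) rpredB ?frobB.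
  by split=> //; have [] := place_invr (sBO b Bb) nmsb.
(* Every element of [O] is a fraction of elements of [B], so the congruence extends to [O]. *)
have frobO x : x \in O -> s x \in O /\ s x - x ^+ p \in m.
  move=> Ox; have [a [b [Ba Bb nmb ->]]] := place_frac Ox.
  have [b0 Obi nmsb Osbi] := unitB b Bb nmb.
  rewrite fmorph_div; split; first by rewrite rpredM ?sBO.
  have sb0 : s b != 0 by rewrite fmorph_eq0.
  have -> : s a / s b - (a / b) ^+ p =
      (s b)^-1 * ((s a - a ^+ p) - (a / b) ^+ p * (s b - b ^+ p)).
    by rewrite expr_div_n; field; rewrite sb0 expf_neq0.
  rewrite place_max_mull // rpredB ?frobB // place_max_mull ?frobB //.
  by rewrite rpredX // rpredM // conj_ring_place.
exists s; split.
  move=> x; split=> [Vsx|/(place_ringE hV)/frobO[/place_ringE]//].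
  (* If [x] is not in [O], then [x^-1] and hence [s x^-1] are in [m]; as [s x] is in [O], their
     product 1 would be in [m]. *)
  apply/(place_ringE hV); apply: contraT => nOx.
  have mxi := place_notin_ring nOx; have [_ mfr] := frobO _ (place_max_ring mxi).
  have : s x^-1 \in m.
    rewrite -[s _](subrK (x^-1 ^+ p)) rpredD //.
    by rewrite place_max_expr ?prime_gt0.
  rewrite fmorphV => msxi; move/(place_ringE hV): Vsx => Osx.
  have x0 : x != 0 by apply: contraNneq nOx => ->; exact: rpred0.
  case/negP: (place_one_notin_max hV).
  by rewrite -(mulfV (_ : s x != 0)) ?fmorph_eq0 // place_max_mull.
by move=> x /(place_ringE hV)/frobO[_ /place_maxE].
Qed.

(** * The subgroup fixing a square root, and induced matrices *)

Lemma galQ_ext (s t : galQ) : s =1 t -> s = t.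
Proof.
case: s t => [f [[fA] [fM]]] [g [[gA] [gM]]] /= /funext efg.
by subst g; rewrite (Prop_irrelevance fA gA) (Prop_irrelevance fM gM).
Qed.

Lemma gmul_ginvK (s t : galQ) x : gmul (ginv s) (gmul s t) x = t x.
Proof. exact: algC_autK. Qed.

Lemma decomp_gmul V s t : decomp V s -> decomp V t -> decomp V (gmul s t).
Proof. by move=> Gs Gt x; rewrite /= Gs Gt. Qed.

Lemma decomp_ginv V s : decomp V s -> decomp V (ginv s).
Proof. by move=> Gs x; rewrite -Gs /= algC_invautK. Qed.

Section QuadraticSubgroup.
Variables (V : set algC) (d : int).
Local Notation r := (sqrtC d%:~R : algC).
Local Notation GK := (quad_subgroup V d).

Lemma gal_sqrtC (s : galQ) : s r = r \/ s r = - r.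
Proof.
have /eqP : s r ^+ 2 = r ^+ 2 by rewrite -rmorphXn /= sqrtCK rmorph_int.
by rewrite eqf_sqr => /orP[] /eqP; auto.
Qed.

Lemma quad_subgroup_sqr s : decomp V s -> GK (gmul s s).
Proof.
move=> Gs; split; first exact: decomp_gmul.
by rewrite /=; case: (gal_sqrtC s) => sr; rewrite !sr ?rmorphN ?sr ?opprK.
Qed.

Lemma quad_subgroup_sign s : decomp V s -> ~ GK s -> s r = - r.
Proof. by move=> Gs nGK; case: (gal_sqrtC s) => // sr; case: nGK. Qed.

Lemma quad_subgroup_neq s : decomp V s -> ~ GK s -> r != - r.
Proof.
move=> Gs nGK; apply/eqP => rN; apply: (nGK); split=> //.
by rewrite quad_subgroup_sign // -rN.
Qed.

Variable (s t : galQ).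
Hypotheses (Gs : decomp V s) (nGKs : ~ GK s) (GKt : GK t).

Lemma ginv_sign : ginv s r = - r.
Proof.
apply: (fmorph_inj s); rewrite rmorphN (quad_subgroup_sign Gs nGKs) opprK.
exact: algC_invautK.
Qed.

Lemma quad_subgroup_coset : ~ GK (gmul t s).
Proof.
case=> _ /=; rewrite quad_subgroup_sign // rmorphN; case: GKt => _ ->.
by move=> rN; case/eqP: (quad_subgroup_neq Gs nGKs).
Qed.

Lemma quad_subgroup_cosetV : ~ GK (gmul (ginv s) t).
Proof.
case=> _ /=; case: GKt => _ ->; rewrite -[algC_invaut _ _]/(ginv s r) ginv_sign.
by move=> rN; case/eqP: (quad_subgroup_neq Gs nGKs).
Qed.

Lemma quad_subgroup_conj : GK (gmul (ginv s) (gmul t s)).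
Proof.
have [Gt tr] := GKt; split.
  by apply: decomp_gmul; [exact: decomp_ginv | exact: decomp_gmul].
rewrite -[LHS]/(ginv s (t (s r))) (quad_subgroup_sign Gs nGKs) !rmorphN tr.
by rewrite ginv_sign opprK.
Qed.

(** Both [t s] and [s^-1 t] send the square root to its opposite, so the off-diagonal entries take
    the default value 0 of [ind_mx]. *)
Lemma ind_mx_diag (A : comUnitRingType) (chi : galQ -> A) :
  ind_mx GK chi s t =
  diag_mx (\row_i [eta (fun=> 0) with 0 |-> chi t,
                   1 |-> chi (gmul (ginv s) (gmul t s))] i).
Proof.
have invgid u : gmul (ginv gid) u = u.
  by apply: galQ_ext => x; exact: (gmul_ginvK gid u).
have mulgid u : gmul u gid = u by exact: galQ_ext.
apply/matrixP => i j; rewrite !mxE.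
case: i j => [[|[|//]] ?] [[|[|//]] ?]; rewrite /= ?invgid ?mulgid ?mulr1n ?mulr0n.
- by rewrite asboolT.
- by rewrite asboolF //; exact: quad_subgroup_coset.
- by rewrite asboolF //; exact: quad_subgroup_cosetV.
- by rewrite asboolT //; exact: quad_subgroup_conj.
Qed.

End QuadraticSubgroup.

(** * The mod l cyclotomic character on inertia and Frobenius *)

Lemma cyclo_eq (k : fieldType) l (s : galQ) n : l \in [pchar k] ->
  (forall z, z ^+ l = 1 -> s z = z ^+ n) -> cyclo k l s = n%:R.
Proof.
move=> lk sn; have l_pr := pcharf_prime lk; have l_gt0 := prime_gt0 l_pr.
have [w w_prim] := C_prim_root_exists l_gt0.
have natr_modl (i : nat) : i%:R = (i %% l)%:R :> k.
  by rewrite {1}(divn_eq i l) natrD natrM (pcharf0 lk) mulr0 add0r.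
(* The exponent picked is congruent to [n] modulo [l], as a primitive root of unity shows. One is
   always found, [n] modulo [l] being eligible, so the default 0 does not occur. *)
rewrite /cyclo /cyclo_exp; case: pickP => [i /asboolP si|none] /=.
  have /eqP : w ^+ i = w ^+ n by rewrite -si ?sn ?(prim_expr_order w_prim).
  rewrite (eq_prim_root_expr w_prim) => /eqP e.
  by rewrite natr_modl e -natr_modl.
have /asboolP[] := negbT (none (Ordinal (ltn_pmod n l_gt0))).
move=> z zl1; rewrite sn //= {1}(divn_eq n l) exprD mulnC exprM zl1 expr1n.
by rewrite mul1r.
Qed.

Section CyclotomicAtPlace.
Variables (p : nat) (V : set algC) (hV : is_place p V) (l : nat) (k : fieldType).
Hypotheses (p_pr : prime p) (lk : l \in [pchar k]) (pNl : p != l).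

Lemma unity_root_place_inj x y : x ^+ l = 1 -> y ^+ l = 1 ->
  place_ideal V (x - y) -> x = y.
Proof.
have l_pr := pcharf_prime lk; have l_gt0 := prime_gt0 l_pr.
move=> xl yl /(place_maxE hV) mxy.
by apply: (place_unity_root_inj p_pr _ l_gt0 xl yl mxy); rewrite dvdn_prime2.
Qed.

Lemma unity_root_place z : z ^+ l = 1 -> V z.
Proof.
have l_gt0 := prime_gt0 (pcharf_prime lk).
by move=> zl; apply/(place_ringE hV)/(place_ring_unity_root hV l_gt0).
Qed.

(** Inertia acts trivially modulo [m], where the [l]-th roots of unity stay distinct. *)
Lemma cyclo_inertia s : inertia V s -> cyclo k l s = 1.
Proof.
move=> [_ sI]; rewrite (cyclo_eq (n := 1)) // => z zl; apply: unity_root_place_inj.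
- by rewrite -rmorphXn zl rmorph1.
- by rewrite expr1.
- by rewrite expr1; apply: sI; exact: unity_root_place.
Qed.

Lemma cyclo_frob_sqr s : is_frob V p s -> cyclo k l (gmul s s) = (p ^ 2)%:R.
Proof.
(* Both sides are [l]-th roots of unity, so their congruence modulo [m] is an equality. *)
move=> [_ sF]; have sE z : z ^+ l = 1 -> s z = z ^+ p.
  move=> zl; apply: unity_root_place_inj.
  - by rewrite -rmorphXn zl rmorph1.
  - by rewrite exprAC zl expr1n.
  - by apply: sF; exact: unity_root_place.
apply: cyclo_eq => // z zl.
by rewrite /= (sE z zl) rmorphXn /= (sE z zl) -exprM mulnn.
Qed.

End CyclotomicAtPlace.

(** * Orders of characters and reduction *)

Lemma order_red_neq1 (A k : idomainType) (red : {rmorphism A -> k}) n y :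
  n%:R != 0 :> k -> y ^+ n = 1 -> red y = 1 -> y = 1.
Proof.
move=> n0 yn redy; apply/eqP; rewrite -subr_eq0.
(* The second factor reduces to [n], which is nonzero in [k]; hence the first one vanishes. *)
have /eqP : (y - 1) * \sum_(i < n) y ^+ i = 0 by rewrite -subrX1 yn subrr.
rewrite mulf_eq0 => /orP[//|/eqP/(congr1 red)].
rewrite rmorph_sum rmorph0 (eq_bigr (fun=> 1)) => [|i _]; last first.
  by rewrite rmorphXn redy expr1n.
by rewrite sumr_const card_ord => /eqP; rewrite (negPf n0).
Qed.

(** The orders 3, 4 and 6 on inertia exceed 2 and divide 12. As [eps3] has square 1, twisting by it
    changes neither the square nor the twelfth power. *)
Lemma inducing_char_order (A : comUnitRingType) (k : fieldType)
    (red : {rmorphism A -> k}) V tau chi : inducing_char red V tau chi ->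
  exists t, [/\ inertia V t, quad_subgroup V (sc_disc tau) t,
    chi t ^+ 12 = 1 & chi t ^+ 2 <> 1].
Proof.
have sc d c r psi : (2 < r)%N -> (r %| 12)%N -> sc_char red V d c r psi ->
    exists t, [/\ inertia V t, quad_subgroup V d t, psi t ^+ 12 = 1
                & psi t ^+ 2 <> 1].
  move=> r2 /dvdnP[q ->] [_ _ [_ psi_r /(_ 2 r2)[t [[It Kt] psi2]]]].
  by exists t; split=> //; rewrite mulnC exprM psi_r ?expr1n.
case: tau => [|||||j] /=; try by apply: sc.
  move=> [psi [/sc[]// t [It Kt psi12 psi2] chiE]].
  have eps2 : eps3 A t ^+ 2 = 1.
    by rewrite /eps3; case: ifP; rewrite ?expr1n ?sqrrN ?expr1n.
  exists t; rewrite chiE // !exprMn eps2 mulr1 psi12 mul1r.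
  by split=> //; rewrite (exprM _ 2 6) eps2 expr1n.
by move=> [scj _]; apply: sc scj.
Qed.

(** * Vanishing of the local cohomology group *)

Lemma H0_ad0_induced (k k' : finFieldType) (iota : {rmorphism k -> k'})
    (l : nat) (V : set algC) (d : int) (rho : galQ -> 'M[k]_2)
    (chi : galQ -> k') :
  l \in [pchar k] -> l != 3 -> ~~ (l %| 8)%N -> is_place 3 V -> is_rep rho ->
  (forall s, \det (rho s) = cyclo k l s) ->
  iso_ind (decomp V) (quad_subgroup V d) (decomp V)
    (fun s => map_mx iota (rho s)) chi ->
  (exists t, [/\ inertia V t, quad_subgroup V d t & chi t ^+ 2 <> 1]) ->
  H0_ad0 l rho (decomp V) = [set 0].
Proof.
move=> lk l3 l8 hV [rhoU _] rho_det [s [g [Gs nGKs gU ind]]] [t0 [It0 Kt0 chit0]].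
have pr3 : prime 3 by [].
have l3' : 3 != l by rewrite eq_sym.
apply/seteqP; split=> [X [_ fixX]|_ ->]; last first.
  by split=> [|t _]; rewrite ?mxtrace0 // mulmx0 mul0mx scaler0.
(* [X] written in the basis of the induced representation. *)
pose Z := invmx g *m map_mx iota X *m g.
pose c t : k' := iota (cyclo k l t).
pose beta t := chi (gmul (ginv s) (gmul t s)).
have diagE t : quad_subgroup V d t -> ind_mx (quad_subgroup V d) chi s t =
    diag_mx (\row_i [eta (fun=> 0) with 0 |-> chi t, 1 |-> beta t] i).
  by move=> Kt; exact: (ind_mx_diag Gs nGKs Kt chi).
have commZ t : decomp V t -> c t *: (ind_mx (quad_subgroup V d) chi s t *m Z) =
    Z *m ind_mx (quad_subgroup V d) chi s t.
  move=> Gt; have fix' : cyclo k l t *: (rho t *m X) = X *m rho t.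
    by rewrite -{2}(fixX t Gt) -scalemxAl mulmxKV.
  have {}fix' : c t *: (map_mx iota (rho t) *m map_mx iota X) =
      map_mx iota X *m map_mx iota (rho t).
    by rewrite -!map_mxM -map_mxZ fix'.
  apply: (can_inj (mulKmx gU)).
  rewrite /Z -scalemxAr !mulmxA (mulmxV gU) mul1mx -ind //.
  rewrite -(mulmxA (map_mx iota _) g) (mulmxV gU).
  by rewrite mulmx1 -[RHS]mulmxA -ind // mulmxA -fix' scalemxAl.
have entry t i j : quad_subgroup V d t ->
    c t * ((\row_i [eta (fun=> 0) with 0 |-> chi t, 1 |-> beta t] i) 0 i * Z i j) =
    Z i j * (\row_i [eta (fun=> 0) with 0 |-> chi t, 1 |-> beta t] i) 0 j.
  move=> Kt; have := commZ t (proj1 Kt); rewrite diagE // => /matrixP/(_ i j).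
  by rewrite mxE mul_diag_mx mul_mx_diag !mxE.
(* The determinant of [rho] read off the diagonal form, [beta] being the conjugate of [chi]. *)
have det_ind t : quad_subgroup V d t -> chi t * beta t = c t.
  move=> Kt; rewrite /c -rho_det -det_map_mx.
  have : \det (map_mx iota (rho t) *m g) =
      \det (g *m ind_mx (quad_subgroup V d) chi s t).
    by rewrite ind //; case: Kt.
  rewrite !det_mulmx mulrC => /(mulrI (_ : \det g \is a GRing.unit)) -> //.
  by rewrite diagE // det_diag big_ord_recl big_ord1 !mxE.
have c0 t : c t != 0.
  by rewrite fmorph_eq0 -rho_det -unitfE -unitmxE.
have chi0 t : quad_subgroup V d t -> chi t != 0 /\ beta t != 0.
  by move=> /det_ind e; apply/andP; rewrite -negb_or -mulf_eq0 e.
have [phi phiF] := exists_frobenius pr3 hV.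
have Kphi : quad_subgroup V d (gmul phi phi) by apply: quad_subgroup_sqr; case: phiF.
(* The value is 9, and [9 - 1 = 8] is where the hypothesis on 8 enters. *)
have cphi : c (gmul phi phi) != 1.
  rewrite /c (cyclo_frob_sqr hV pr3 lk l3' phiF) rmorph_nat.
  rewrite (natrD _ 8 1 : (3 ^ 2)%:R = _) -subr_eq0 addrK.
  by rewrite -(dvdn_pcharf (rmorph_pchar iota lk)).
have diag0 (a x : k') : a != 0 -> c (gmul phi phi) * (a * x) = x * a -> x = 0.
  move=> a0 e; apply/eqP; move: e => /eqP; rewrite (mulrC x) -subr_eq0.
  rewrite -[X in _ - X]mul1r.
  by rewrite -mulrBl !mulf_eq0 subr_eq0 (negPf cphi) (negPf a0).
have [chiphi0 betaphi0] := chi0 _ Kphi.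
(* Equality would give [chi t0 ^+ 2 = c t0 = 1]. *)
have chibeta0 : chi t0 != beta t0.
  apply: contra_not_neq chit0 => e; rewrite expr2 {2}e det_ind //.
  by rewrite /c (cyclo_inertia hV pr3 lk l3' It0) rmorph1.
have ct0 : c t0 = 1 by rewrite /c (cyclo_inertia hV pr3 lk l3' It0) rmorph1.
have off0 (a b x : k') : a != b -> c t0 * (a * x) = x * b -> x = 0.
  rewrite ct0 mul1r (mulrC x) => ab /eqP; rewrite -subr_eq0 -mulrBl mulf_eq0.
  by rewrite subr_eq0 (negPf ab) => /eqP.
(* The square of Frobenius kills the diagonal entries, and [t0] the other two. *)
have Z0 : Z = 0.
  apply/matrixP => i j; rewrite [RHS]mxE.
  have eP := entry _ i j Kphi; have e0 := entry _ i j Kt0; move: eP e0.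
  rewrite !mxE; case: i j => [[|[|//]] ?] [[|[|//]] ?] /= eP e0.
  - exact: diag0 eP.
  - exact: off0 e0.
  - by apply: off0 e0; rewrite eq_sym.
  - exact: diag0 eP.
have iX0 : map_mx iota X = 0.
  apply: (can_inj (mulKmx (_ : invmx g \in unitmx))); first by rewrite unitmx_inv.
  by apply: (can_inj (mulmxK gU)); rewrite -/Z Z0 mulmx0 mul0mx.
by apply/eqP; rewrite -(map_mx_eq0 iota) iX0.
Qed.

(** * Primes l at least 5 and the supercuspidal types at 3 *)

Theorem corollary5p2 (l : nat) (l_prime : prime l) (l_ge5 : (5 <= l)%N) :
  (3 != -1 %[mod l%:Z])%Z /\
  (forall
    (R : realType) (N : nat) (f : R[i] -> R[i]) (a : nat -> int)
    (E : weierstrass rat)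
    (k k' : finFieldType) (iota : {rmorphism k -> k'})
    (O : idomainType) (red : {rmorphism O -> k'})
    (D : deformation_problem k) (rhoE : galQ -> 'M[O]_2)
    (V : set algC) (tau : sc_type3) (chi : galQ -> O),
    let rhobar := dp_residual D in
    let S := dp_ramset D in
    let G3 := decomp V in
    let GK := quad_subgroup V (sc_disc tau) in
    let chibar := fun s => red (chi s) in
    newform2 N f a -> wdisc E != 0 -> has_conductor E N -> corresponds a E ->
    l \in [pchar k] -> ~~ (l %| N)%N -> ~~ (l%:Z %| a l)%Z ->
    is_deformation_problem D -> {subset primes (N * l) <= S} ->
    residual_rep_of N l a rhobar -> odd_rep rhobar -> abs_irreducible rhobar ->
    padic_integers red -> tate_rep l E rhoE ->
    minimally_ramified iota red N rhoE D ->
    (9 %| N)%N -> is_place 3 V ->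
    additive_reduction 3 E -> potentially_good V E ->
    has_inertial_type red V rhoE tau chi ->
    iso_ind G3 GK G3 (fun s => map_mx iota (rhobar s)) chibar ->
    neq_conj G3 GK chibar ->
    H0_ad0 l rhobar G3 = [set 0] /\ locally_unobstructed l D V).
Proof.
(* To be applied to 4, 6 and 8, whose only prime factors are 2 and 3. *)
have l_ndvd n : (0 < n)%N -> all (fun q => q < 5)%N (primes n) -> ~~ (l %| n)%N.
  move=> n0 /allP small; apply/negP => ln.
  have /small : l \in primes n by rewrite mem_primes l_prime n0.
  by rewrite ltnNge l_ge5.
(* Here 4 is [3 - (-1)]. *)
split; first by rewrite eqz_mod_dvd; exact: (l_ndvd 4).
move=> R N f a E k k' iota O red D rhoE V tau chi rhobar S G3 GK chibar.
move=> _ _ _ _ lk _ _ [_ [rho_rep _ _] _ _ _] _ [_ _ rho_det] _ _ _ _ _ _ hV _ _.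
move=> [ind_chi _] iso_chi _.
suff H0 : H0_ad0 l rhobar G3 = [set 0] by split=> // - [].
apply: (H0_ad0_induced lk _ _ hV rho_rep rho_det iso_chi).
- by apply: contraTneq l_ge5 => ->.
- exact: l_ndvd.
have [t [It Kt chi12 chi2]] := inducing_char_order ind_chi.
exists t; split=> //; rewrite /chibar -rmorphXn => red1; apply: chi2.
(* Since [chi t ^+ 12 = 1], the square of [chi t] is a sixth root of unity, and 6 is nonzero in
   [k']. *)
apply: (order_red_neq1 (n := 6) _ _ red1); last by rewrite -exprM.
rewrite -(dvdn_pcharf (rmorph_pchar iota lk)); exact: l_ndvd.
Qed.
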